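(* Let $q$ be an odd prime power and let $G=\mathrm{PSL}(2,q)$ act on the projective line $\mathbb{F}_q\cup\{\infty\}$ by fractional linear transformations. Let $S$ and $N$ be the sets of nonzero squares and non-squares of $\mathbb{F}_q$, fix a non-square $\zeta$, and put $L_s=\{g\in G: g(0)\in S\}$, $\Pi=\{(s,t): s\in S, t\in N, t-s\in S\}$, $\Lambda=\{(s,t): s,t\in S, t-s\in N\}$. For a set $\Omega$ of pairs of points let $A_\Omega=\{g\in G:(g(0),g(\infty))\in\Omega\}$ and $-\Omega=\{(a,b):(\zeta a,\zeta b)\in\Omega\}$. If $q\equiv 3\pmod 4$, then $(L_s\setminus A_\Pi)\cup A_{-\Pi}$ is a Cameron-Liebler set; if $q\equiv 1\pmod 4$, then $(L_s\setminus A_\Lambda)\cup A_{-\Lambda}$ is a Cameron-Liebler set.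
   Context: For $a,b$ in the projective line, the star is $G_{a\to b}=\{g\in G:g(a)=b\}$ with indicator vector $\mathbf{v}_{a,b}$. A Cameron-Liebler set (for this action) is a subset of $G$ whose indicator vector is a linear combination of the $\mathbf{v}_{a,b}$. *)

(* Defs.v *)
From HB Require Import structures.
From mathcomp Require Import all_boot all_order all_algebra all_fingroup all_solvable.

Set Implicit Arguments.
Unset Strict Implicit.
Unset Printing Implicit Defensive.

Import GRing.Theory.
Local Open Scope ring_scope.

Section FractionalLinear.

Variable F : finFieldType.
Implicit Types (A B : 'M[F]_2) (x : option F).

(* The projective line over F is [option F]: [Some x] is the point x of F and
   [None] is the point at infinity. *)

(* x |-> (a x + b) / (c x + d) for A = (a b; c d). It is a permutation of the
   line when A is invertible. *)
Definition moebius A x : option F :=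
  let num := if x is Some y then A 0 0 * y + A 0 1 else A 0 0 in
  let den := if x is Some y then A 1 0 * y + A 1 1 else A 1 0 in
  if den == 0 then None else Some (num / den).

Definition SL2 : {set {'GL_2[F]}} := [set u | \det (GLval u) == 1].

Lemma SL2_group_set : group_set SL2.
Proof.
apply/group_setP; split=> [|u v].
  by rewrite inE GL_1E det1.
by rewrite !inE GL_MxE det_mulmx => /eqP-> /eqP->; rewrite mulr1.
Qed.

Canonical SL2_group := Group SL2_group_set.

Definition PSL2 : {group coset_of 'Z(SL2)%g} := (SL2 / 'Z(SL2)%g)%G.

(* The action of PSL(2,F) on the projective line; [pslE] shows that the choice
   of a representative matrix is immaterial. *)
Definition psl (g : coset_of 'Z(SL2)%g) x : option F := moebius (GLval (repr g)) x.

Let hvec x : 'cV[F]_2 :=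
  \col_i (if i == 0 then (if x is Some y then y else 1)
          else (if x is Some _ then 1 else 0)).

Let hpt (v : 'cV[F]_2) : option F :=
  if v 1 0 == 0 then None else Some (v 0 0 / v 1 0).

Let moebiusE A x : moebius A x = hpt (A *m hvec x).
Proof.
rewrite /moebius /hpt !mxE !big_ord_recl !big_ord0 !mxE /= !addr0.
have -> : lift ord0 ord0 = 1 :> 'I_2 by exact: val_inj.
by case: x => [y|]; rewrite ?mulr1 ?mulr0 ?addr0.
Qed.

Let hptZ (c : F) (v : 'cV[F]_2) : c != 0 -> hpt (c *: v) = hpt v.
Proof.
move=> c0; rewrite /hpt !mxE mulf_eq0 (negPf c0) /=.
by case: ifP => // v0; rewrite -mulf_div divff // mul1r.
Qed.

Let hvecK (v : 'cV[F]_2) : v != 0 -> exists2 c, c != 0 & v = c *: hvec (hpt v).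
Proof.
move=> v0; rewrite /hpt; case: eqP => [v10|/eqP v10].
  exists (v 0 0).
    apply: contraNneq v0 => v00; apply/eqP/matrixP => i j.
    rewrite (ord1 j) !mxE; case: (unliftP 0 i) => [k|] ->; last by [].
    by rewrite (ord1 k) -[RHS]v10; congr (v _ _); exact: val_inj.
  apply/matrixP => i j; rewrite (ord1 j) !mxE.
  case: (unliftP 0 i) => [k|] ->; last by rewrite eqxx mulr1.
  by rewrite (ord1 k) /= mulr0 -[RHS]v10; congr (v _ _); exact: val_inj.
exists (v 1 0) => //.
apply/matrixP => i j; rewrite (ord1 j) !mxE.
case: (unliftP 0 i) => [k|] ->; last by rewrite eqxx mulrCA divff ?mulr1.
by rewrite (ord1 k) /= mulr1; congr (v _ _); exact: val_inj.
Qed.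

Let hvec_neq0 x : hvec x != 0.
Proof.
apply/eqP => /matrixP h; case: x h => [y|] h.
  by have /eqP := h 1 0; rewrite !mxE /= oner_eq0.
by have /eqP := h 0 0; rewrite !mxE /= oner_eq0.
Qed.

Lemma moebiusM (A : 'M[F]_2) (B : 'M[F]_2) x :
  B \in unitmx -> moebius (A *m B) x = moebius A (moebius B x).
Proof.
move=> uB; rewrite !moebiusE.
have Bx0 : B *m hvec x != 0.
  apply: contraNneq (hvec_neq0 x) => Bx.
  by rewrite -[hvec x](mulKmx uB) Bx mulmx0.
have [c c0 e] := hvecK Bx0.
by rewrite -mulmxA {1}e -scalemxAr hptZ.
Qed.

Lemma moebius_scalar a x : a != 0 -> moebius a%:M x = x.
Proof.
move=> a0; rewrite moebiusE mul_scalar_mx hptZ //.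
case: x => [y|]; rewrite /hpt !mxE /= ?eqxx //.
by rewrite oner_eq0 divr1.
Qed.

Let SL2_of_proof A : \det A = 1 -> A \is a GRing.unit.
Proof. by move=> dA; rewrite unitmxE dA unitr1. Qed.

Lemma SL2_centerE (u : {'GL_2[F]}) :
  u \in 'Z(SL2)%g -> exists2 a, a != 0 & GLval u = a%:M.
Proof.
case/centerP=> _ cu.
pose E (i j : 'I_2) : 'M[F]_2 := 1%:M + delta_mx i j.
have comE i j : \det (E i j) = 1 ->
    GLval u *m delta_mx i j = delta_mx i j *m GLval u.
  move=> dE; pose e : {'GL_2[F]} := Sub (E i j) (SL2_of_proof dE).
  have eS : e \in SL2 by rewrite inE; apply/eqP.
  have := congr1 (@GLval _ _) (cu _ eS); rewrite !GL_MxE.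
  have -> : GLval e = 1%:M + delta_mx i j by [].
  rewrite mulmxDr mulmxDl mulmx1 mul1mx; exact: addrI.
have d10 : \det (E 1 0) = 1.
  rewrite det_trig; first by rewrite !big_ord_recl big_ord0 !mxE /= !addr0 !mulr1.
  apply/is_trig_mxP => i j; rewrite !mxE.
  by case: i => [[|[|i]] ilt]; case: j => [[|[|j]] jlt] //=; rewrite addr0.
have d01 : \det (E 0 1) = 1.
  rewrite -d10 -det_tr; congr (\det _).
  by rewrite /E linearD /= trmx1 trmx_delta.
have ord2 (i : 'I_2) : (i = 0) + (i = 1).
  case: (unliftP 0 i) => [k|] ->; [right | by left].
  by rewrite (ord1 k); exact: val_inj.
have s1 : (lift ord0 ord0 : 'I_2) = 1 by exact: val_inj.
have h01 (i j : 'I_2) := congr1 (fun M : 'M[F]_2 => M i j) (comE _ _ d01).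
have h10 (i j : 'I_2) := congr1 (fun M : 'M[F]_2 => M i j) (comE _ _ d10).
have := h01 0 0; have := h01 0 1; have := h10 1 1.
rewrite !mxE !big_ord_recl !big_ord0 !s1 !mxE /=.
rewrite !(addr0, add0r, mulr0, mul0r, mulr1, mul1r) => u01 u00 u10.
have uE : GLval u = (GLval u 0 0)%:M.
  apply/matrixP => i j; rewrite mxE.
  by case: (ord2 i) => ->; case: (ord2 j) => ->; rewrite /= ?mulr1n ?mulr0n.
exists (GLval u 0 0) => //.
have := GL_det u; rewrite uE det_scalar mxE eqxx mulr1n.
by apply: contraNneq => ->; rewrite expr0n.
Qed.

Lemma pslE (u : {'GL_2[F]}) x :
  u \in SL2 -> psl (coset 'Z(SL2)%g u) x = moebius (GLval u) x.
Proof.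
move=> uS; have nu : u \in ('N('Z(SL2)))%g.
  by rewrite (subsetP (normal_norm (center_normal SL2_group))).
rewrite /psl val_coset //; case/rcosetP: (mem_repr_rcoset 'Z(SL2)%g u) => z zZ ->.
have [a a0 za] := SL2_centerE zZ.
change (moebius (GLval z *m GLval u) x = moebius (GLval u) x).
rewrite za moebiusM ?moebius_scalar //; exact: GL_unit u.
Qed.

(* 0 is neither in [squares] nor, being 0 ^+ 2, in [nonsquares]. *)
Definition squares : {set F} := [set x | x != 0 & [exists y, x == y ^+ 2]].
Definition nonsquares : {set F} := [set x | ~~ [exists y, x == y ^+ 2]].

Definition Lsq : {set coset_of 'Z(SL2)%g} :=
  [set g in PSL2 | psl g (Some 0) \in Some @: squares].

Definition Pi_pairs : {set option F * option F} :=
  [set (Some p.1, Some p.2) | p : F * F in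
     [set p | [&& p.1 \in squares, p.2 \in nonsquares
                & p.2 - p.1 \in squares]]].

Definition Lambda_pairs : {set option F * option F} :=
  [set (Some p.1, Some p.2) | p : F * F in
     [set p | [&& p.1 \in squares, p.2 \in squares
                & p.2 - p.1 \in nonsquares]]].

Definition Apairs (Omega : {set option F * option F}) :
    {set coset_of 'Z(SL2)%g} :=
  [set g in PSL2 | (psl g (Some 0), psl g None) \in Omega].

(* -Omega, for a given zeta; multiplication by zeta fixes infinity. *)
Definition negpairs (zeta : F) (Omega : {set option F * option F}) :
    {set option F * option F} :=
  [set ab | (omap ( *%R zeta) ab.1, omap ( *%R zeta) ab.2) \in Omega].

Definition star (a b : option F) : {set coset_of 'Z(SL2)%g} :=
  [set g in PSL2 | psl g a == b].

End FractionalLinear.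

Definition indicator (K : fieldType) (T : finType) (A : {set T}) :
  {ffun T -> K^o} := [ffun g => (g \in A)%:R].

(* Every element of [coset_of 'Z(SL2 F)%g]
   outside [PSL2 F] lies in no star, so working with vectors indexed by the
   ambient type is the same as working with vectors indexed by [PSL2 F]. *)
Definition Cameron_Liebler (K : fieldType) (F : finFieldType)
    (Y : {set coset_of 'Z(SL2 F)%g}) : Prop :=
  Y \subset PSL2 F /\
  exists c : option F -> option F -> K,
    indicator K Y = \sum_a \sum_b c a b *: indicator K (star a b).

(* Main.v *)
(* Let chi be the quadratic character, chi 0 = 0, and e = chi (-1). Both Pi
   (where e = -1) and Lambda (where e = 1) are the set Omega of the pairs (s, t)
   with chi s = 1, chi t = e and chi (t - s) = -e. For g = (a b; c d) of
   determinant 1, g(0) = b/d, g(oo) = a/c and g(oo) - g(0) = 1/(cd), so that the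
   term chi s * chi t * chi (t - s) in the expansion of the indicator of Omega
   collapses to chi (ab), and
     4 (1_{A_Omega} - 1_{A_{-Omega}}) (g)
       = chi (bd) + e chi (ac) - e chi (cd) - chi (ab)
       = chi (g 0) + e chi (g oo) - chi (g^-1 oo) - e chi (g^-1 0).
   Every term depends on g(0), g(oo), g^-1(0) or g^-1(oo) alone, hence is a
   combination of stars. *)
Require Import Defs.
From mathcomp Require Import all_boot all_order all_algebra all_fingroup.
From mathcomp Require Import cyclic center finfield ring.

Local Open Scope ring_scope.
Set Implicit Arguments.
Unset Strict Implicit.
Unset Printing Implicit Defensive.

Import Order.TTheory GRing.Theory Num.Theory.

(** * Squares and non-squares in a finite field *)

Lemma unit_generator (F : finFieldType) :
  exists u : {unit F}, #[u]%g = #|F|.-1 /\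
    forall x : F, x != 0 -> exists i, x = FinRing.uval u ^+ i.
Proof.
have /cyclicP [u uE] := field_unit_group_cyclic [set: {unit F}]%G.
exists u; split; first by rewrite orderE -uE card_finField_unit.
move=> x x0; have xU : x \is a GRing.unit by rewrite unitfE.
have : FinRing.unit F xU \in <[u]>%g by rewrite -uE inE.
by case/cycleP => i /(congr1 val) /= ->; exists i; rewrite FinRing.val_unitX.
Qed.

(** The order of the additive group kills 1, whereas an odd multiple of 1 would equal 1 if 2 were
    0. *)
Lemma odd_card_2_neq0 (F : finFieldType) : odd #|F| -> 2%:R != 0 :> F.
Proof.
move=> qodd; apply: contraNneq (oner_neq0 F) => two0.
have := expg_cardG (in_setT (1 : F)); rewrite cardsT FinRing.zmodXgE.
by rewrite -(odd_double_half #|F|) qodd -mul2n mulrnDr mulrnA two0 mul0rn addr0 => /eqP.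
Qed.

(** Non-squares are odd powers of a generator of the unit group, and two odd exponents have an even
    sum. *)
Lemma nonsquaresM (F : finFieldType) (x y : F) :
  x \in nonsquares F -> y \in nonsquares F -> x * y \in squares F.
Proof.
have nz (z : F) : z \in nonsquares F -> z != 0.
  by apply: contraTneq => ->; rewrite inE negbK; apply/existsP; exists 0; rewrite expr0n.
have [u [_ gen]] := unit_generator F.
have oddE (z : F) : z \in nonsquares F -> exists i, z = FinRing.uval u ^+ (i.*2.+1).
  move=> zN; have [i zE] := gen _ (nz _ zN).
  have iodd : odd i.
    apply: contraTT zN => ieven; rewrite inE negbK; apply/existsP.
    exists (FinRing.uval u ^+ i./2); rewrite zE -exprM muln2.
    by rewrite -{1}(odd_double_half i) (negPf ieven).
  by exists i./2; rewrite zE -{1}(odd_double_half i) iodd.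
move=> xN yN; rewrite inE mulf_neq0 ?nz //=; apply/existsP.
have [i ->] := oddE _ xN; have [j ->] := oddE _ yN.
exists (FinRing.uval u ^+ (i + j).+1).
by rewrite -exprM -exprD muln2 addSn addnS doubleS doubleD.
Qed.

Lemma squares_N1 (F : finFieldType) : odd #|F| ->
  #|F| = 1 %[mod 4] -> -1 \in squares F.
Proof.
move=> qodd q1; have two0 := odd_card_2_neq0 qodd.
have [u [ordu _]] := unit_generator F.
have qE : #|F| = (#|F| %/ 4 * 4).+1 by rewrite {1}(divn_eq #|F| 4) q1 addn1.
have k0 : (0 < #|F| %/ 4)%N by have := finNzRing_gt1 F; rewrite {1}qE; case: (_ %/ _)%N.
set k := (#|F| %/ 4)%N in qE k0; rewrite inE oppr_eq0 oner_eq0; apply/existsP.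
(* With q = 4k + 1 the generator [u] has order 4k, so u^(2k) is a square root of 1 other than 1,
   that is, -1. *)
exists (FinRing.uval u ^+ k); rewrite -exprM eq_sym.
have sq1 : (FinRing.uval u ^+ (k * 2)) ^+ 2 == 1.
  rewrite -exprM -mulnA -FinRing.val_unitX.
  have -> : (k * (2 * 2) = #[u]%g)%N by rewrite ordu qE.
  by rewrite expg_order.
move: sq1; rewrite -subr_eq0 subr_sqr_1 mulf_eq0 subr_eq0 addr_eq0 => /orP[|//].
rewrite -FinRing.val_unitX => /eqP u1.
have /eqP : (u ^+ (k * 2))%g = 1%g by apply: val_inj.
rewrite -order_dvdn ordu qE /= => /dvdn_leq; rewrite muln_gt0 k0 => /(_ isT).
by rewrite leq_pmul2l.
Qed.

(** If y^2 = -1 then y^4 = 1, so y = y^q = y^3 = -y and 2y = 0, which is impossible. *)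
Lemma nonsquares_N1 (F : finFieldType) : odd #|F| ->
  #|F| = 3 %[mod 4] -> -1 \in nonsquares F.
Proof.
move=> qodd q3; have two0 := odd_card_2_neq0 qodd.
rewrite inE; apply/negP => /existsP [y /eqP yE].
have y0 : y != 0 by apply: contra_eq_neq yE => ->; rewrite expr0n /= oppr_eq0 oner_eq0.
have y4 : y ^+ 4 = 1 by rewrite (exprM y 2 2) -yE sqrrN expr1n.
have := expf_card y; rewrite (divn_eq #|F| 4) q3 exprD mulnC exprM y4 expr1n mul1r.
move=> y3; have : 2%:R * y == 0 by rewrite mulr_natl mulr2n -{1}y3 exprS -yE; apply/eqP; ring.
by rewrite mulf_eq0 (negPf two0) (negPf y0).
Qed.

(** * The quadratic character with values in [K] *)

Section QuadraticCharacter.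

Context {K : numFieldType} {F : finFieldType}.
Implicit Types x y : F.

Definition chi (x : F) : K :=
  if x == 0 then 0 else if x \in squares F then 1 else -1.

Lemma chi0 : chi 0 = 0.
Proof. by rewrite /chi eqxx. Qed.

Lemma squaresPn x : x != 0 -> (x \in nonsquares F) = (x \notin squares F).
Proof. by move=> x0; rewrite !inE x0. Qed.

Lemma zero_notin_nonsquares : (0 \in nonsquares F) = false.
Proof. by rewrite inE; apply/negbF/existsP; exists 0; rewrite expr0n. Qed.

Lemma neg1_neq1 : (-1 == 1 :> K) = false.
Proof. by rewrite lt_eqF // (lt_trans (ltrN10 K)). Qed.

Lemma squares_chi x : (x \in squares F) = (chi x == 1).
Proof.
rewrite /chi; case: (eqVneq x 0) => [->|x0]; first by rewrite eq_sym oner_eq0 inE eqxx.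
by case: ifP; rewrite ?eqxx ?neg1_neq1.
Qed.

Lemma nonsquares_chi x : (x \in nonsquares F) = (chi x == -1).
Proof.
rewrite /chi; case: (eqVneq x 0) => [->|x0].
  by rewrite zero_notin_nonsquares eq_sym oppr_eq0 oner_eq0.
by rewrite squaresPn //; case: ifP; rewrite ?eqxx // eq_sym neg1_neq1.
Qed.

Lemma chi_val x : x != 0 -> chi x = 1 \/ chi x = -1.
Proof. by rewrite /chi => /negPf ->; case: ifP; [left | right]. Qed.

Lemma chi_sqr x : x != 0 -> chi x * chi x = 1.
Proof. by case/chi_val => ->; rewrite ?mulrNN mulr1. Qed.

Lemma squares_mull x y : x \in squares F -> (x * y \in squares F) = (y \in squares F).
Proof.
rewrite !inE => /andP[x0 /existsP[a /eqP xE]]; rewrite mulf_eq0 (negPf x0) /=.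
have a0 : a != 0 by apply: contraNneq x0 => a0; rewrite xE a0 expr0n.
case: eqP => //= _; apply/existsP/existsP => -[b /eqP bE].
  by exists (b / a); rewrite expr_div_n -bE xE [_ * y]mulrC mulfK ?expf_neq0.
by exists (a * b); rewrite exprMn -bE xE.
Qed.

Lemma chiM x y : chi (x * y) = chi x * chi y.
Proof.
rewrite /chi mulf_eq0; case: (eqVneq x 0) => [_|x0]; first by rewrite mul0r.
case: (eqVneq y 0) => [_|y0]; first by rewrite mulr0.
case: (boolP (x \in squares F)) => xS; first by rewrite squares_mull ?mul1r.
case: (boolP (y \in squares F)) => yS.
  by rewrite mulrC squares_mull // (negPf xS) mulr1.
by rewrite nonsquaresM ?squaresPn // mulrNN mulr1.
Qed.

Lemma chi1 : chi 1 = 1.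
Proof.
by apply/eqP; rewrite -squares_chi inE oner_eq0; apply/existsP; exists 1; rewrite expr1n.
Qed.

(** Every nonzero value is its own inverse, so a quotient of matrix entries has the same character
    as their product. *)
Lemma chiV x : chi x^-1 = chi x.
Proof.
have [->|x0] := eqVneq x 0; first by rewrite invr0.
by rewrite -[LHS]mulr1 -(chi_sqr x0) mulrA -chiM mulVf // chi1 mul1r.
Qed.

End QuadraticCharacter.

(** * Matrices of determinant 1 and their action on the line *)

Section Matrix2.

Context {F : finFieldType}.
Implicit Types A : 'M[F]_2.

Lemma det_mx22 A : \det A = A 0 0 * A 1 1 - A 0 1 * A 1 0.
Proof.
have l0 : lift 0 0 = 1 :> 'I_2 by exact: val_inj.
have l1 : lift 1 0 = 0 :> 'I_2 by exact: val_inj.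
rewrite (expand_det_row A 0) !big_ord_recl big_ord0 /cofactor !det_mx11 !mxE.
rewrite !l0 l1 /= !expr0 expr1 !mul1r addr0.
by rewrite mulN1r mulrN.
Qed.

Lemma invmx22 A : \det A = 1 ->
  [/\ invmx A 0 0 = A 1 1, invmx A 0 1 = - A 0 1,
      invmx A 1 0 = - A 1 0 & invmx A 1 1 = A 0 0].
Proof.
move=> dA; have l0 : lift 0 0 = 1 :> 'I_2 by exact: val_inj.
have l1 : lift 1 0 = 0 :> 'I_2 by exact: val_inj.
have uA : A \in unitmx by rewrite unitmxE dA unitr1.
rewrite /invmx uA dA invr1 scale1r !mxE /cofactor !det_mx11 !mxE !l0 !l1 /=.
by rewrite !expr0 expr1 expr2 !mul1r !mulN1r opprK mul1r.
Qed.

Lemma moebiusV A (x y : option F) : A \in unitmx ->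
  (moebius A x == y) = (x == moebius (invmx A) y).
Proof.
have mK B z : B \in unitmx -> moebius B (moebius (invmx B) z) = z.
  by move=> uB; rewrite -moebiusM ?unitmx_inv // mulmxV // moebius_scalar ?oner_neq0.
move=> uA; apply/eqP/eqP => [<-|->]; last exact: mK.
by rewrite -{2}(invmxK A) mK ?unitmx_inv.
Qed.

Lemma PSL2P (g : coset_of 'Z(SL2 F)%g) :
  reflect (exists2 u, u \in SL2 F & g = coset 'Z(SL2 F)%g u) (g \in PSL2 F).
Proof.
apply: (iffP idP) => [/morphimP [u _ uS ->]|[u uS ->]]; first by exists u.
exact: mem_quotient.
Qed.

End Matrix2.

(** A function of g(0) is a combination of the stars from 0, with weight [f0 b] on the star from 0
    to b. Since g^-1(0) = a exactly when g(a) = 0, a function of g^-1(0) is a combination of the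
    stars into 0. The same holds for infinity. *)
Lemma Cameron_Liebler_ends (K : fieldType) (F : finFieldType)
    (Y : {set coset_of 'Z(SL2 F)%g}) (f0 f1 k0 k1 : option F -> K) :
  Y \subset PSL2 F ->
  (forall u, u \in SL2 F ->
     (coset 'Z(SL2 F)%g u \in Y)%:R =
       f0 (moebius (GLval u) (Some 0)) + f1 (moebius (GLval u) None)
       + k0 (moebius (invmx (GLval u)) (Some 0)) + k1 (moebius (invmx (GLval u)) None)) ->
  Cameron_Liebler K Y.
Proof.
move=> sY fE; split => //.
exists (fun a b => (a == Some 0)%:R * f0 b + (a == None)%:R * f1 b
                   + (b == Some 0)%:R * k0 a + (b == None)%:R * k1 a).
apply/ffunP => g; rewrite sum_ffunE ffunE.
under eq_bigr do rewrite sum_ffunE.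
have [gG|gG] := boolP (g \in PSL2 F); last first.
  rewrite (contraNF (subsetP sY g) gG) big1 // => a _; rewrite big1 // => b _.
  by rewrite !ffunE inE (negPf gG) scaler0.
have /PSL2P [u uS gE] := gG; rewrite gE fE //.
have pick1 (h : option F -> K) x : \sum_a (a == x)%:R * h a = h x.
  rewrite (bigD1 x) //= eqxx mul1r big1 ?addr0 // => a /negPf ->.
  by rewrite mul0r.
pose c a b : K := (a == Some 0)%:R * f0 b + (a == None)%:R * f1 b
                   + (b == Some 0)%:R * k0 a + (b == None)%:R * k1 a.
(* Among the stars from a, only the one to g(a) contains g. *)
rewrite [RHS](_ : _ = \sum_a c a (moebius (GLval u) a)); last first.
  apply: eq_bigr => a _.
  rewrite (bigD1 (moebius (GLval u) a)) //= !ffunE inE -gE gG gE pslE // eqxx.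
  rewrite /= [_ *: _]mulr1 big1 ?addr0 // => b.
  rewrite eq_sym => /negPf bN; rewrite !ffunE inE pslE // bN andbF.
  exact: scaler0.
(* The tests g(a) = 0 and g(a) = oo become a = g^-1(0) and a = g^-1(oo), so that [pick1] evaluates
   all four sums. *)
rewrite /c; under [RHS]eq_bigr => a _ do rewrite !(moebiusV _ _ (GL_unit u)).
rewrite !big_split /= (pick1 (fun a => f0 (moebius (GLval u) a))).
by rewrite (pick1 (fun a => f1 (moebius (GLval u) a))) (pick1 k0) (pick1 k1).
Qed.

(** * The sets of pairs and the character identity *)

Section Pairs.

Context {K : numFieldType} {F : finFieldType}.
Local Notation chi := (@chi K F).

Definition char_pairs (e : K) : {set option F * option F} :=
  [set p | if p is (Some x, Some y)
           then [&& chi x == 1, chi y == e & chi (y - x) == - e] else false].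

Lemma mem_Some_pairs (P : pred (F * F)) (p : option F * option F) :
  (p \in [set (Some q.1, Some q.2) | q : F * F in [set q | P q]]) =
  (if p is (Some x, Some y) then P (x, y) else false).
Proof.
apply/imsetP/idP => [[[x y] /=] | ]; first by rewrite inE => Pq ->.
by case: p => [[x|] [y|]] // Pq; exists (x, y) => //; rewrite inE.
Qed.

Lemma Pi_pairsE : Pi_pairs F = char_pairs (-1).
Proof.
apply/setP => p; rewrite mem_Some_pairs inE.
by case: p => [[x|] [y|]] //=; rewrite !(@squares_chi K) (@nonsquares_chi K) opprK.
Qed.

Lemma Lambda_pairsE : Lambda_pairs F = char_pairs 1.
Proof.
apply/setP => p; rewrite mem_Some_pairs inE.
by case: p => [[x|] [y|]] //=; rewrite !(@squares_chi K) (@nonsquares_chi K).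
Qed.

(** The value 0 at infinity makes the character of the point x / y equal to chi x * chi y even when
    y = 0. *)
Definition chiP (x : option F) : K := oapp chi 0 x.

Lemma mem_Some_squares (x : option F) : (x \in Some @: squares F) = (chiP x == 1).
Proof.
case: x => [x|] /=; first by rewrite (mem_imset _ _ Some_inj) (@squares_chi K).
by rewrite eq_sym oner_eq0; apply/imsetP => -[].
Qed.

Lemma Cameron_Liebler_char_pairs (zeta : F) : zeta \in nonsquares F ->
  Cameron_Liebler K
    ((Lsq F :\: Apairs (char_pairs (chi (-1))))
       :|: Apairs (negpairs zeta (char_pairs (chi (-1))))).
Proof.
rewrite (@nonsquares_chi K) => /eqP zetaN; set e := chi (-1).
have n1 : -1 != 0 :> F by rewrite oppr_eq0 oner_neq0.
have chiPE x y : chiP (if y == 0 then None else Some (x / y)) = chi x * chi y.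
  case: eqP => [->|_] /=; first by rewrite chi0 mulr0.
  by rewrite chiM chiV.
(* A_Omega lies in L_s and A_{-Omega} is disjoint from L_s, so the indicator is 1_{L_s} -
   (1_{A_Omega} - 1_{A_{-Omega}}). The first term depends on g(0) alone; the difference contributes
   the quarters. *)
apply: (@Cameron_Liebler_ends _ _ _
  (fun x => (chiP x == 1)%:R - chiP x / 4%:R) (fun x => - e * chiP x / 4%:R)
  (fun x => e * chiP x / 4%:R) (fun x => chiP x / 4%:R)).
  by apply/subsetP => g; rewrite !inE => /orP[/andP[_]|] /andP[].
move=> u uS; have gG : coset 'Z(SL2 F)%g u \in PSL2 F by apply/PSL2P; exists u.
rewrite !inE gG /= !pslE // mem_Some_squares.
have dA : \det (GLval u) = 1 by apply/eqP; rewrite inE in uS.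
have [i00 i01 i10 i11] := invmx22 dA.
rewrite /moebius i00 i01 i10 i11 !mulr0 !add0r {i00 i01 i10 i11}.
move: dA; rewrite det_mx22.
move: (GLval u 0 0) (GLval u 0 1) (GLval u 1 0) (GLval u 1 1) => a b c d dA.
rewrite !chiPE -(mulN1r b) (chiM (-1) b) -(mulN1r c) (chiM (-1) c) -/e.
have chi_eq0 x : chi x = 0 -> x = 0.
  by case: (eqVneq x 0) => // /(@chi_val K F) [] -> /eqP; rewrite ?oppr_eq0 oner_eq0.
(* What the case analysis keeps of ad - bc = 1: if an entry vanishes, then -bc = 1 or ad = 1. The
   only other trace of it is [diffE]. *)
have a0E : chi a = 0 -> e * chi b * chi c = 1.
  by move/chi_eq0 => a0; rewrite -!chiM -mulrA mulN1r -(@chi1 K F) -dA a0 mul0r sub0r.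
have b0E : chi b = 0 -> chi a * chi d = 1.
  by move/chi_eq0 => b0; rewrite -chiM -(@chi1 K F) -dA b0 mul0r subr0.
have c0E : chi c = 0 -> chi a * chi d = 1.
  by move/chi_eq0 => c0; rewrite -chiM -(@chi1 K F) -dA c0 mulr0 subr0.
have d0E : chi d = 0 -> e * chi b * chi c = 1.
  by move/chi_eq0 => d0; rewrite -!chiM -mulrA mulN1r -(@chi1 K F) -dA d0 mulr0 sub0r.
have zero_neq1 : (0 == 1 :> K) = false by rewrite eq_sym oner_eq0.
have one_neq_neg1 : (1 == -1 :> K) = false by rewrite eq_sym neg1_neq1.
have signE := (@mulr0 K, @mul0r K, @mulr1 K, @mul1r K, @mulrN K, @mulNr K, @opprK K,
  @eqxx K, zero_neq1, one_neq_neg1, @neg1_neq1 K, @oppr0 K, andbF).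
have absurd0 : 0 = 1 :> K -> False by move/eqP; rewrite zero_neq1.
have absurdN : -1 = 1 :> K -> False by move/eqP; rewrite neg1_neq1.
have eV : e = 1 \/ e = -1 by exact: chi_val n1.
have signs := @chi_val K F.
have vals x : [\/ chi x = 0, chi x = 1 | chi x = -1].
  case: (eqVneq x 0) => [->|/signs [] xE]; first by constructor 1; exact: chi0.
    by constructor 2.
  by constructor 3.
have diffE : c != 0 -> d != 0 -> a / c - b / d = (c * d)^-1.
  by move=> c0 d0; rewrite -[RHS]mul1r -dA; field; rewrite c0 d0.
(* From here on [e] is just a sign, so both residues of q mod 4 are treated at once. *)
clearbody e; clear u uS gG chiPE n1 chi_eq0 dA.
(* If d = 0, then g(0) = oo and g lies in none of the three sets; the terms cancel because chi b = e
   chi c. *)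
have [d0|d0] := eqVneq d 0.
{ move: a0E b0E c0E d0E; rewrite d0 chi0 /= => {diffE} _ _ _ /(_ erefl).
  case: eV => ->; case: (vals a) => ->; case: (vals b) => ->; case: (vals c) => ->.
  all: rewrite ?signE ?eqxx /= ?signE => bcE.
  all: by [case/absurd0: bcE | case/absurdN: bcE | field]. }
(* If c = 0, then g(oo) = oo and only L_s matters; chi (bd) and chi (ab) cancel because chi a = chi
   d. *)
have [c0|c0] := eqVneq c 0.
{ move: a0E b0E c0E d0E; rewrite c0 chi0 /= => {diffE} _ _ /(_ erefl) + _.
  case: eV => ->; case: (vals a) => ->; case: (vals b) => ->; case: (signs _ d0) => ->.
  all: rewrite ?signE ?eqxx /= ?signE => adE.
  all: by [case/absurd0: adE | case/absurdN: adE | field]. }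
rewrite /= -mulrBr diffE // !(chiM, chiV) zetaN.
(* Both images are now finite. For a and b nonzero the identity holds for every choice of signs; for
   a = 0 or b = 0, [a0E] and [b0E] exclude the sign patterns that would violate it. *)
move: a0E b0E; clear - signE absurd0 absurdN eV signs vals c0 d0.
case: eV => ->; case: (signs _ c0) => ->; case: (signs _ d0) => ->;
  case: (vals a) => ->; case: (vals b) => ->.
all: rewrite ?signE ?eqxx /= ?signE => a0E b0E.
all: by [case/absurd0: (a0E erefl) | case/absurdN: (a0E erefl)
        | case/absurd0: (b0E erefl) | case/absurdN: (b0E erefl) | field].
Qed.

End Pairs.

Theorem theorem7p3 (K : numFieldType) (F : finFieldType) (zeta : F)
    (odd_q : odd #|F|) (zetaN : zeta \in nonsquares F) :
  (#|F| = 3 %[mod 4] ->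
     Cameron_Liebler K
       ((Lsq F :\: Apairs (Pi_pairs F))
          :|: Apairs (negpairs zeta (Pi_pairs F)))) /\
  (#|F| = 1 %[mod 4] ->
     Cameron_Liebler K
       ((Lsq F :\: Apairs (Lambda_pairs F))
          :|: Apairs (negpairs zeta (Lambda_pairs F)))).
Proof.
split=> q_mod.
  have /eqP N1 : chi (-1 : F) == -1 :> K by rewrite -nonsquares_chi nonsquares_N1.
  by rewrite (Pi_pairsE (K := K)) -N1; apply: Cameron_Liebler_char_pairs.
have /eqP N1 : chi (-1 : F) == 1 :> K by rewrite -squares_chi squares_N1.
by rewrite (Lambda_pairsE (K := K)) -N1; apply: Cameron_Liebler_char_pairs.
Qed.
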